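(* Let $A$ be a Green $\mathcal{D}$-biset functor over $k$ and $G\in Ob(\mathcal{D})$. The map $$\widetilde{\_}:A(G)\longrightarrow End_{\mathcal{P}_A}(G),\qquad a\mapsto \widetilde{a}:=A(Ind(\Delta))(a),$$ where $\Delta:G\to G\times G$, $g\mapsto(g,g)$, is an injective $k$-algebra homomorphism.
   Context: All groups are finite; rings and algebras are associative and unital, with unit-preserving homomorphisms. Let $k$ be a commutative ring. $B(H,G)$ is the Burnside (Grothendieck) group of finite $(H,G)$-bisets (with $[X\sqcup Y]=[X]+[Y]$), and $B_k(H,G)=k\otimes B(H,G)$. The composition of a $(K,H)$-biset $Y$ and an $(H,G)$-biset $X$ is $Y\circ X=Y\times_H X$, the quotient of $Y\times X$ by $(yh,x)\sim(y,hx)$. The biset category $\mathcal{C}$ has all finite groups as objects, $Hom_{\mathcal{C}}(G,H)=B(H,G)$, composition $\circ$, and identity of $G$ the regular $(G,G)$-biset $G$. $\mathcal{D}\subseteq\mathcal{C}$ is a full subcategory whose objects are closed under subquotients and direct products; $k\mathcal{D}$ is its $k$-linearization. A $\mathcal{D}$-biset functor over $k$ is a $k$-linear functor $k\mathcal{D}\to {}_kMod$. For a homomorphism $\phi:G\to H$: $Ind(\phi)$ is $H$ as an $(H,G)$-biset ($h'\cdot h\cdot g=h'h\phi(g)$), and $Res(\phi)$ is $H$ as a $(G,H)$-biset ($g\cdot h\cdot h'=\phi(g)hh'$). $Inf_G^{G\times H}$ is $Res$ of the projection $G\times H\to G$. A Green $\mathcal{D}$-biset functor over $k$ is a $\mathcal{D}$-biset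 functor $A$ such that each $A(G)$ is a $k$-algebra and, for each homomorphism $\phi:G\to H$ of groups in $Ob(\mathcal{D})$: $A(Res(\phi))$ is a $k$-algebra homomorphism, and $a\,A(Ind(\phi))(b)=A(Ind(\phi))(A(Res(\phi))(a)b)$, $A(Ind(\phi))(b)\,a=A(Ind(\phi))(b\,A(Res(\phi))(a))$ for $a\in A(H)$, $b\in A(G)$. For $a\in A(G)$, $b\in A(H)$ put $a\times b=A(Inf_G^{G\times H})(a)\,A(Inf_H^{G\times H})(b)\in A(G\times H)$, and let $\epsilon_A=1\in A(1)$. The associated category $\mathcal{P}_A$ has objects $Ob(\mathcal{D})$, $Hom_{\mathcal{P}_A}(G,H)=A(H\times G)$, composition $\alpha\circ\beta=A(K\times\overleftarrow{H}\times G)(\alpha\times\beta)$ for $\alpha\in A(K\times H)$, $\beta\in A(H\times G)$, and identity $A(\overrightarrow{G})(\epsilon_A)$ of $G$. Here $\overrightarrow{G}$ is $G$ as a $(G\times G,1)$-biset via $(g_1,g_2)\cdot g=g_1gg_2^{-1}$, and $K\times\overleftarrow{H}\times G$ is the $(K\times G,K\times H\times H\times G)$-biset $K\times H\times G$ with $(k',g')\cdot(k,h,g)\cdot(k_1,h_1,h_2,g_1)=(k'kk_1,h_1^{-1}hh_2,g'gg_1)$. In particular $End_{\mathcal{P}_A}(G)=A(G\times G)$ is a $k$-algebra under $\circ$. *)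

(* Defs.v *)
From HB Require Import structures.
From mathcomp Require Import all_boot all_order all_fingroup all_algebra.
From mathcomp Require Import generic_quotient.
From mathcomp Require Import boolp.

Set Implicit Arguments.
Unset Strict Implicit.
Unset Printing Implicit Defensive.

Import GRing.Theory.

Local Open Scope ring_scope.
Local Open Scope quotient_scope.

Record biset_on (H G : finGroupType) (X : finType) := BisetOn {
  lact : H -> X -> X;
  ract : X -> G -> X;
  lact1 : forall x, lact 1%g x = x;
  lactM : forall h h' x, lact (h * h')%g x = lact h (lact h' x);
  ract1 : forall x, ract x 1%g = x;
  ractM : forall x g g', ract x (g * g')%g = ract (ract x g) g';
  lractA : forall h x g, ract (lact h x) g = lact h (ract x g) }.

Record biset (H G : finGroupType) := Biset {
  carrier :> finType;
  biset_str :> biset_on H G carrier }.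

Definition biso (H G : finGroupType) (X Y : biset H G) : Prop :=
  exists f : X -> Y,
    [/\ bijective f,
        forall h x, f (lact X h x) = lact Y h (f x) &
        forall x g, f (ract X x g) = ract Y (f x) g].

Section DisjointUnion.
Variables (H G : finGroupType) (X Y : biset H G).

Definition dunion_lact (h : H) (z : X + Y) : X + Y :=
  match z with inl x => inl (lact X h x) | inr y => inr (lact Y h y) end.
Definition dunion_ract (z : X + Y) (g : G) : X + Y :=
  match z with inl x => inl (ract X x g) | inr y => inr (ract Y y g) end.

Lemma dunion_lact1 z : dunion_lact 1%g z = z.
Proof. by case: z => z /=; rewrite lact1. Qed.
Lemma dunion_lactM h h' z :
  dunion_lact (h * h')%g z = dunion_lact h (dunion_lact h' z).
Proof. by case: z => z /=; rewrite lactM. Qed.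
Lemma dunion_ract1 z : dunion_ract z 1%g = z.
Proof. by case: z => z /=; rewrite ract1. Qed.
Lemma dunion_ractM z g g' :
  dunion_ract z (g * g')%g = dunion_ract (dunion_ract z g) g'.
Proof. by case: z => z /=; rewrite ractM. Qed.
Lemma dunion_lractA h z g :
  dunion_ract (dunion_lact h z) g = dunion_lact h (dunion_ract z g).
Proof. by case: z => z /=; rewrite lractA. Qed.

Definition dunion : biset H G :=
  Biset (BisetOn dunion_lact1 dunion_lactM dunion_ract1 dunion_ractM
                 dunion_lractA).
End DisjointUnion.

Definition empty_biset (H G : finGroupType) : biset H G.
Proof.
by exists void; exists (fun _ x => x) (fun x _ => x).
Defined.

Definition regular_biset (G : finGroupType) : biset G G.
Proof.
exists G; exists (fun h x => (h * x)%g) (fun x g => (x * g)%g).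
- exact: mul1g.
- by move=> h h' x; rewrite mulgA.
- exact: mulg1.
- by move=> x g g'; rewrite mulgA.
- by move=> h x g; rewrite mulgA.
Defined.

Section Composition.
Variables (K H G : finGroupType) (Y : biset K H) (X : biset H G).

Definition tens_eq : rel (Y * X) := fun p q =>
  [exists h : H, (p.1 == ract Y q.1 h) && (q.2 == lact X h p.2)].

Lemma tens_eq_refl : reflexive tens_eq.
Proof. by move=> p; apply/existsP; exists 1%g; rewrite ract1 lact1 !eqxx. Qed.

Lemma tens_eq_sym : symmetric tens_eq.
Proof.
suff imp p q : tens_eq p q -> tens_eq q p by move=> p q; apply/idP/idP; apply: imp.
case: p q => p1 p2 [q1 q2] /existsP[h /andP[/= /eqP-> /eqP->]].
apply/existsP; exists h^-1%g; rewrite /=.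
by rewrite -ractM -lactM mulgV mulVg ract1 lact1 !eqxx.
Qed.

Lemma tens_eq_trans : transitive tens_eq.
Proof.
case=> q1 q2 [p1 p2] [r1 r2] /existsP[h /andP[/= /eqP-> /eqP->]].
case/existsP=> h' /andP[/= /eqP-> /eqP->]; apply/existsP; exists (h' * h)%g.
by rewrite /= -ractM -lactM !eqxx.
Qed.

Canonical tens_equiv := EquivRel tens_eq tens_eq_refl tens_eq_sym tens_eq_trans.

Definition tens_type : finType := quot_type {eq_quot tens_equiv}.

Definition tens_pi (p : Y * X) : tens_type := \pi_({eq_quot tens_equiv}) p.
Definition tens_repr (z : tens_type) : Y * X :=
  repr (z : {eq_quot tens_equiv}).

Lemma tens_reprK z : tens_pi (tens_repr z) = z.
Proof. exact: (@reprK _ {eq_quot tens_equiv}). Qed.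

Lemma tens_piP p q : tens_pi p = tens_pi q <->
  exists h : H, p.1 = ract Y q.1 h /\ q.2 = lact X h p.2.
Proof.
split.
  move/(@eqmodP _ tens_equiv)/existsP=> [h /andP[/eqP ? /eqP ?]].
  by exists h.
case=> h [e1 e2]; apply/(@eqmodP _ tens_equiv)/existsP; exists h.
by rewrite e1 e2 !eqxx.
Qed.

Lemma tens_pi_ract y h x : tens_pi (ract Y y h, x) = tens_pi (y, lact X h x).
Proof. by apply/tens_piP; exists h. Qed.

Definition tens_lact (l : K) (z : tens_type) : tens_type :=
  tens_pi (lact Y l (tens_repr z).1, (tens_repr z).2).
Definition tens_ract (z : tens_type) (g : G) : tens_type :=
  tens_pi ((tens_repr z).1, ract X (tens_repr z).2 g).

Lemma tens_lactE l p : tens_lact l (tens_pi p) = tens_pi (lact Y l p.1, p.2).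
Proof.
have /tens_piP[h [e1 e2]] := tens_reprK (tens_pi p).
by apply/tens_piP; exists h; rewrite /= e1 -lractA.
Qed.

Lemma tens_ractE p g : tens_ract (tens_pi p) g = tens_pi (p.1, ract X p.2 g).
Proof.
have /tens_piP[h [e1 e2]] := tens_reprK (tens_pi p).
by apply/tens_piP; exists h; rewrite /= e2 -lractA.
Qed.

Lemma tens_lact1 z : tens_lact 1%g z = z.
Proof. by rewrite /tens_lact lact1 -surjective_pairing tens_reprK. Qed.
Lemma tens_lactM l l' z :
  tens_lact (l * l')%g z = tens_lact l (tens_lact l' z).
Proof. by rewrite -(tens_reprK z) !tens_lactE lactM. Qed.
Lemma tens_ract1 z : tens_ract z 1%g = z.
Proof. by rewrite /tens_ract ract1 -surjective_pairing tens_reprK. Qed.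
Lemma tens_ractM z g g' :
  tens_ract z (g * g')%g = tens_ract (tens_ract z g) g'.
Proof. by rewrite -(tens_reprK z) !tens_ractE ractM. Qed.
Lemma tens_lractA l z g :
  tens_ract (tens_lact l z) g = tens_lact l (tens_ract z g).
Proof.
by rewrite -(tens_reprK z) !(tens_lactE, tens_ractE).
Qed.

Definition bcomp : biset K G :=
  Biset (BisetOn tens_lact1 tens_lactM tens_ract1 tens_ractM tens_lractA).
End Composition.

Section Isomorphisms.
Variables H G : finGroupType.
Implicit Types X Y Z : biset H G.

Lemma biso_refl X : biso X X.
Proof. by exists id; split=> //; exists id. Qed.

Lemma biso_sym X Y : biso X Y -> biso Y X.
Proof.
case=> f [[g fK gK] fl fr]; exists g; split; first by exists f.
  by move=> h y; apply: (can_inj fK); rewrite fl !gK.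
by move=> y h; apply: (can_inj fK); rewrite fr !gK.
Qed.

Lemma biso_trans X Y Z : biso X Y -> biso Y Z -> biso X Z.
Proof.
case=> f [fb fl fr] [g [gb gl gr]]; exists (g \o f); split.
- exact: bij_comp.
- by move=> h x /=; rewrite fl gl.
- by move=> x h /=; rewrite fr gr.
Qed.

Lemma biso_dunion X X' Y Y' :
  biso X X' -> biso Y Y' -> biso (dunion X Y) (dunion X' Y').
Proof.
case=> f [[f' fK f'K] fl fr] [g [[g' gK g'K] gl gr]].
exists (fun z : X + Y => match z with inl x => inl (f x) | inr y => inr (g y) end
          : dunion X' Y').
split.
- exists (fun z : X' + Y' =>
            match z with inl x => inl (f' x) | inr y => inr (g' y) end).
    by case=> z; rewrite ?fK ?gK.
  by case=> z; rewrite ?f'K ?g'K.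
- by move=> h [] z /=; rewrite ?fl ?gl.
- by move=> [] z h /=; rewrite ?fr ?gr.
Qed.

Lemma biso_dunionC X Y : biso (dunion X Y) (dunion Y X).
Proof.
exists (fun z : X + Y => match z with inl x => inr x | inr y => inl y end
          : dunion Y X).
split; [|by move=> h []|by case].
by exists (fun z : Y + X => match z with inl x => inr x | inr y => inl y end);
  case.
Qed.

Lemma biso_dunionA X Y Z :
  biso (dunion X (dunion Y Z)) (dunion (dunion X Y) Z).
Proof.
exists (fun z : X + (Y + Z) =>
          match z with
          | inl x => inl (inl x) | inr (inl y) => inl (inr y)
          | inr (inr z) => inr z end : dunion (dunion X Y) Z).
split; [|by move=> h [|[]]|by case=> [|[]]].
by exists (fun z : X + Y + Z =>
          match z with
          | inl (inl x) => inl x | inl (inr y) => inr (inl y)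
          | inr z => inr (inr z) end); [case=> [|[]]|case=> [[]|]].
Qed.

Lemma biso_dunion0 X : biso (dunion X (empty_biset H G)) X.
Proof.
exists (fun z : X + void => match z with inl x => x | inr v => of_void X v end).
by split=> //; [exists inl => // -[]|move=> h []|case].
Qed.

End Isomorphisms.

Lemma tens_map (K H G : finGroupType) (Y Y' : biset K H) (X X' : biset H G)
    (f : Y -> Y') (g : X -> X') :
    (forall y h, f (ract Y y h) = ract Y' (f y) h) ->
    (forall h x, g (lact X h x) = lact X' h (g x)) ->
  {F : bcomp Y X -> bcomp Y' X' |
     forall p, F (tens_pi p) = tens_pi (f p.1, g p.2)}.
Proof.
move=> fr gl; exists (fun z => tens_pi (f (tens_repr z).1, g (tens_repr z).2)).
move=> p; have /tens_piP[h [e1 e2]] := tens_reprK (tens_pi p).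
by apply/tens_piP; exists h; rewrite /= e1 e2 fr gl.
Qed.

Lemma biso_bcomp (K H G : finGroupType) (Y Y' : biset K H) (X X' : biset H G) :
  biso Y Y' -> biso X X' -> biso (bcomp Y X) (bcomp Y' X').
Proof.
case=> f [[f' fK f'K] fl fr] [g [[g' gK g'K] gl gr]].
have fr' y h : f' (ract Y' y h) = ract Y (f' y) h.
  by apply: (can_inj fK); rewrite fr !f'K.
have gl' h x : g' (lact X' h x) = lact X h (g' x).
  by apply: (can_inj gK); rewrite gl !g'K.
have [F FE] := tens_map fr gl; have [F' FE'] := tens_map fr' gl'.
exists F; split.
- exists F' => z; rewrite -(tens_reprK z) !(FE, FE') /=.
    by rewrite fK gK -surjective_pairing.
  by rewrite f'K g'K -surjective_pairing.
- move=> l z; rewrite -(tens_reprK z) /= tens_lactE !FE tens_lactE /=.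
  by rewrite fl.
- move=> z l; rewrite -(tens_reprK z) /= tens_ractE !FE tens_ractE /=.
  by rewrite gr.
Qed.

Lemma biso_bcompDl (K H G : finGroupType) (Y Y' : biset K H) (X : biset H G) :
  biso (bcomp (dunion Y Y') X) (dunion (bcomp Y X) (bcomp Y' X)).
Proof.
pose F (z : bcomp (dunion Y Y') X) : dunion (bcomp Y X) (bcomp Y' X) :=
  match (tens_repr z).1 with
  | inl y => inl (tens_pi (y, (tens_repr z).2))
  | inr y => inr (tens_pi (y, (tens_repr z).2)) end.
have FE (p : dunion Y Y' * X) : F (tens_pi p) = match p.1 with
  | inl y => inl (tens_pi (y, p.2)) | inr y => inr (tens_pi (y, p.2)) end.
  have /tens_piP[h] := tens_reprK (tens_pi p).
  rewrite /F; move: (tens_repr _) => r; case: r p => [z x] [[y|y'] x'] /= [-> ->] /=.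
    by congr inl; apply/tens_piP; exists h.
  by congr inr; apply/tens_piP; exists h.
pose F' (z : dunion (bcomp Y X) (bcomp Y' X)) : bcomp (dunion Y Y') X :=
  match z with
  | inl p => tens_pi (inl (tens_repr p).1 : dunion Y Y', (tens_repr p).2)
  | inr p => tens_pi (inr (tens_repr p).1 : dunion Y Y', (tens_repr p).2) end.
exists F; split.
- exists F' => [z|[]z].
  + rewrite -(tens_reprK z) FE /F'; case: (tens_repr z) => [[y|y] x] /=.
      move: (tens_reprK (tens_pi (y, x))); case: (tens_repr (tens_pi _)).
      move=> y' x' /tens_piP[h /= [-> ->]]; exact: (tens_pi_ract (inl y : dunion Y Y')).
    move: (tens_reprK (tens_pi (y, x))); case: (tens_repr (tens_pi _)).
    move=> y' x' /tens_piP[h /= [-> ->]]; exact: (tens_pi_ract (inr y : dunion Y Y')).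
  + by rewrite /F' FE /= -surjective_pairing tens_reprK.
  + by rewrite /F' FE /= -surjective_pairing tens_reprK.
- move=> l z; rewrite -(tens_reprK z) /= tens_lactE !FE /=.
  by case: (tens_repr z) => [[y|y] x] /=; rewrite tens_lactE.
- move=> z g; rewrite -(tens_reprK z) /= tens_ractE !FE /=.
  by case: (tens_repr z) => [[y|y] x] /=; rewrite tens_ractE.
Qed.

Lemma biso_bcompDr (K H G : finGroupType) (Y : biset K H) (X X' : biset H G) :
  biso (bcomp Y (dunion X X')) (dunion (bcomp Y X) (bcomp Y X')).
Proof.
pose F (z : bcomp Y (dunion X X')) : dunion (bcomp Y X) (bcomp Y X') :=
  match (tens_repr z).2 with
  | inl x => inl (tens_pi ((tens_repr z).1, x))
  | inr x => inr (tens_pi ((tens_repr z).1, x)) end.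
have FE (p : Y * dunion X X') : F (tens_pi p) = match p.2 with
  | inl x => inl (tens_pi (p.1, x)) | inr x => inr (tens_pi (p.1, x)) end.
  have /esym/tens_piP[h] := tens_reprK (tens_pi p).
  rewrite /F; move: (tens_repr _) => r; case: r p => [y z] [y' [x|x]] /= [-> ->] /=.
    by congr inl; apply/esym/tens_piP; exists h.
  by congr inr; apply/esym/tens_piP; exists h.
pose F' (z : dunion (bcomp Y X) (bcomp Y X')) : bcomp Y (dunion X X') :=
  match z with
  | inl p => tens_pi ((tens_repr p).1, inl (tens_repr p).2 : dunion X X')
  | inr p => tens_pi ((tens_repr p).1, inr (tens_repr p).2 : dunion X X') end.
exists F; split.
- exists F' => [z|[]z].
  + rewrite -(tens_reprK z) FE /F'; case: (tens_repr z) => [y [x|x]] /=.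
      move: (tens_reprK (tens_pi (y, x))); case: (tens_repr (tens_pi _)).
      move=> y' x' /tens_piP[h /= [-> ->]]; exact: (tens_pi_ract y _ (inl _ : dunion X X')).
    move: (tens_reprK (tens_pi (y, x))); case: (tens_repr (tens_pi _)).
    move=> y' x' /tens_piP[h /= [-> ->]]; exact: (tens_pi_ract y _ (inr _ : dunion X X')).
  + by rewrite /F' FE /= -surjective_pairing tens_reprK.
  + by rewrite /F' FE /= -surjective_pairing tens_reprK.
- move=> l z; rewrite -(tens_reprK z) /= tens_lactE !FE /=.
  by case: (tens_repr z) => [y [x|x]] /=; rewrite tens_lactE.
- move=> z g; rewrite -(tens_reprK z) /= tens_ractE !FE /=.
  by case: (tens_repr z) => [y [x|x]] /=; rewrite tens_ractE.
Qed.

Section Grothendieck.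
Variable M : nmodType.

Definition groth_eq : rel (M * M) := fun p q =>
  `[< exists z, p.1 + q.2 + z = q.1 + p.2 + z >].

Lemma groth_eq_refl : reflexive groth_eq.
Proof. by move=> p; apply/asboolP; exists 0. Qed.

Lemma groth_eq_sym : symmetric groth_eq.
Proof. by move=> p q; apply/asboolP/asboolP => -[z e]; exists z; rewrite e. Qed.

Lemma groth_eq_trans : transitive groth_eq.
Proof.
move=> q p r /asboolP[z e] /asboolP[w e']; apply/asboolP.
exists (q.1 + q.2 + z + w).
rewrite [LHS](@GRing.add M).[AC (2*4) ((1*4*5)*(3*2*6))] e e'.
by rewrite [LHS](@GRing.add M).[AC (3*3) (4*2*(1*5*3*6))].
Qed.

Canonical groth_equiv :=
  EquivRel groth_eq groth_eq_refl groth_eq_sym groth_eq_trans.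

Definition groth : Type := {eq_quot groth_equiv}.
HB.instance Definition _ := Choice.on groth.

Definition groth_pi (p : M * M) : groth := \pi_({eq_quot groth_equiv}) p.
Definition groth_repr (x : groth) : M * M := repr (x : {eq_quot groth_equiv}).

Lemma groth_reprK x : groth_pi (groth_repr x) = x.
Proof. exact: (@reprK _ {eq_quot groth_equiv}). Qed.

Lemma groth_piP p q : groth_pi p = groth_pi q <->
  exists z, p.1 + q.2 + z = q.1 + p.2 + z.
Proof.
split; first by move/(@eqmodP _ groth_equiv)/asboolP.
by move=> e; apply/(@eqmodP _ groth_equiv)/asboolP.
Qed.

Definition groth_zero : groth := groth_pi (0, 0).
Definition groth_add (x y : groth) : groth :=
  let p := groth_repr x in let q := groth_repr y in
  groth_pi (p.1 + q.1, p.2 + q.2).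
Definition groth_opp (x : groth) : groth :=
  let p := groth_repr x in groth_pi (p.2, p.1).

Lemma groth_addE p q :
  groth_add (groth_pi p) (groth_pi q) = groth_pi (p.1 + q.1, p.2 + q.2).
Proof.
have /groth_piP[z e] := groth_reprK (groth_pi p).
have /groth_piP[w e'] := groth_reprK (groth_pi q).
apply/groth_piP; exists (z + w) => /=.
rewrite [LHS](@GRing.add M).[AC (2*2*2) ((1*3*5)*(2*4*6))] e e'.
by rewrite [LHS](@GRing.add M).[AC (3*3) ((1*4)*(2*5)*(3*6))].
Qed.

Lemma groth_oppE p : groth_opp (groth_pi p) = groth_pi (p.2, p.1).
Proof.
have /groth_piP[z e] := groth_reprK (groth_pi p).
by apply/groth_piP; exists z; rewrite /= ![_.2 + _.1]addrC e.
Qed.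

Lemma groth_addA : associative groth_add.
Proof.
move=> x y z; rewrite -(groth_reprK x) -(groth_reprK y) -(groth_reprK z).
by rewrite !groth_addE /= !addrA.
Qed.
Lemma groth_addC : commutative groth_add.
Proof.
by move=> x y; rewrite /groth_add /=; congr (groth_pi (_, _)); rewrite addrC.
Qed.
Lemma groth_add0 : left_id groth_zero groth_add.
Proof.
move=> x; rewrite -{1}(groth_reprK x) groth_addE /= !add0r.
by rewrite -surjective_pairing groth_reprK.
Qed.
Lemma groth_addN : left_inverse groth_zero groth_opp groth_add.
Proof.
move=> x; rewrite -(groth_reprK x) groth_oppE groth_addE.
by apply/groth_piP; exists 0; rewrite /= !addr0 add0r addrC.
Qed.

HB.instance Definition _ :=
  GRing.isZmodule.Build groth groth_addA groth_addC groth_add0 groth_addN.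

Definition groth_in (m : M) : groth := groth_pi (m, 0).

Lemma groth_inD m n : groth_in (m + n) = groth_in m + groth_in n.
Proof. by rewrite [RHS]groth_addE /= addr0. Qed.

Lemma groth_piE p : groth_pi p = groth_in p.1 - groth_in p.2.
Proof.
rewrite [- _]groth_oppE [RHS]groth_addE /= addr0 add0r.
by rewrite -surjective_pairing.
Qed.

Definition groth_lift (V : zmodType) (f : M -> V) (x : groth) : V :=
  f (groth_repr x).1 - f (groth_repr x).2.

Section Lift.
Variables (V : zmodType) (f : M -> V) (fD : {morph f : m n / m + n}).

Lemma groth_lift_pi p : groth_lift f (groth_pi p) = f p.1 - f p.2.
Proof.
have /groth_piP[z] := groth_reprK (groth_pi p); rewrite /groth_lift.
move: (groth_repr _) => q /(congr1 f); rewrite !fD => /addIr e.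
by apply/eqP; rewrite subr_eq addrAC eq_sym subr_eq e.
Qed.

Lemma groth_liftE m : groth_lift f (groth_in m) = f m.
Proof.
rewrite groth_lift_pi /=; have /eqP : f (0 + 0) = f 0 + f 0 by rewrite fD.
by rewrite addr0 -subr_eq subrr => /eqP <-; rewrite subr0.
Qed.

Lemma groth_liftD : {morph groth_lift f : x y / x + y}.
Proof.
move=> x y; rewrite -(groth_reprK x) -(groth_reprK y) [_ + _]groth_addE.
by rewrite !groth_lift_pi /= !fD opprD addrACA.
Qed.
End Lift.
End Grothendieck.

(* Every finite biset is isomorphic to one on a standard finite set; these
   form a small type. *)
Record sbiset (H G : finGroupType) := SBiset {
  sdeg : nat;
  sbiset_str : biset_on H G 'I_sdeg }.

Coercion of_sbiset (H G : finGroupType) (s : sbiset H G) : biset H G :=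
  Biset (sbiset_str s).

HB.instance Definition _ H G := gen_eqMixin (sbiset H G).
HB.instance Definition _ H G := gen_choiceMixin (sbiset H G).

Section ToSmall.
Variables (H G : finGroupType) (X : biset H G).

Definition small_lact (h : H) (i : 'I_#|X|) : 'I_#|X| :=
  enum_rank (lact X h (enum_val i)).
Definition small_ract (i : 'I_#|X|) (g : G) : 'I_#|X| :=
  enum_rank (ract X (enum_val i) g).

Lemma small_lact1 i : small_lact 1%g i = i.
Proof. by rewrite /small_lact lact1 enum_valK. Qed.
Lemma small_lactM h h' i :
  small_lact (h * h')%g i = small_lact h (small_lact h' i).
Proof. by rewrite /small_lact lactM enum_rankK. Qed.
Lemma small_ract1 i : small_ract i 1%g = i.
Proof. by rewrite /small_ract ract1 enum_valK. Qed.
Lemma small_ractM i g g' :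
  small_ract i (g * g')%g = small_ract (small_ract i g) g'.
Proof. by rewrite /small_ract ractM enum_rankK. Qed.
Lemma small_lractA h i g :
  small_ract (small_lact h i) g = small_lact h (small_ract i g).
Proof. by rewrite /small_ract /small_lact !enum_rankK lractA. Qed.

Definition to_sbiset : sbiset H G :=
  SBiset (BisetOn small_lact1 small_lactM small_ract1 small_ractM
                  small_lractA).

Lemma to_sbisetP : biso X to_sbiset.
Proof.
exists (enum_rank : X -> to_sbiset); split.
- by exists enum_val; [apply: enum_rankK|apply: enum_valK].
- by move=> h x; rewrite /= /small_lact enum_rankK.
- by move=> h x; rewrite /= /small_ract enum_rankK.
Qed.
End ToSmall.

Section IsoClasses.
Variables H G : finGroupType.

Definition bisob : rel (sbiset H G) := fun X Y => `[< biso X Y >].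

Lemma bisob_refl : reflexive bisob.
Proof. by move=> X; apply/asboolP; apply: biso_refl. Qed.
Lemma bisob_sym : symmetric bisob.
Proof. by move=> X Y; apply/asboolP/asboolP; apply: biso_sym. Qed.
Lemma bisob_trans : transitive bisob.
Proof.
move=> Y X Z /asboolP XY /asboolP YZ; apply/asboolP.
exact: biso_trans XY YZ.
Qed.

Canonical bisob_equiv := EquivRel bisob bisob_refl bisob_sym bisob_trans.

Definition isoclass : Type := {eq_quot bisob_equiv}.
HB.instance Definition _ := Choice.on isoclass.

Definition iso_pi (X : biset H G) : isoclass :=
  \pi_({eq_quot bisob_equiv}) (to_sbiset X).
Definition iso_repr (c : isoclass) : biset H G :=
  repr (c : {eq_quot bisob_equiv}).

Lemma iso_piP X Y : iso_pi X = iso_pi Y <-> biso X Y.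
Proof.
split=> [/(@eqmodP _ bisob_equiv)/asboolP XY|XY].
  apply: biso_trans (to_sbisetP X) (biso_trans XY _).
  exact/biso_sym/to_sbisetP.
apply/(@eqmodP _ bisob_equiv)/asboolP.
apply: biso_trans (biso_sym (to_sbisetP X)) (biso_trans XY _).
exact: to_sbisetP.
Qed.

Lemma iso_reprK c : iso_pi (iso_repr c) = c.
Proof.
rewrite -[RHS](@reprK _ {eq_quot bisob_equiv}).
apply/(@eqmodP _ bisob_equiv)/asboolP.
exact/biso_sym/to_sbisetP.
Qed.

Lemma iso_pi_repr X : biso (iso_repr (iso_pi X)) X.
Proof. by apply/iso_piP; rewrite iso_reprK. Qed.

Definition iso_zero : isoclass := iso_pi (empty_biset H G).
Definition iso_add (c d : isoclass) : isoclass :=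
  iso_pi (dunion (iso_repr c) (iso_repr d)).

Lemma iso_addE X Y : iso_add (iso_pi X) (iso_pi Y) = iso_pi (dunion X Y).
Proof. by apply/iso_piP/biso_dunion; apply: iso_pi_repr. Qed.

Lemma iso_addA : associative iso_add.
Proof.
move=> c d e; rewrite -(iso_reprK c) -(iso_reprK d) -(iso_reprK e).
by rewrite !iso_addE; apply/iso_piP/biso_dunionA.
Qed.
Lemma iso_addC : commutative iso_add.
Proof. by move=> c d; apply/iso_piP/biso_dunionC. Qed.
Lemma iso_add0 : left_id iso_zero iso_add.
Proof.
move=> c; rewrite iso_addC -(iso_reprK c) iso_addE.
exact/iso_piP/biso_dunion0.
Qed.

HB.instance Definition _ :=
  GRing.isNmodule.Build isoclass iso_addA iso_addC iso_add0.

Definition burnside : zmodType := groth isoclass.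

Definition bclass (X : biset H G) : burnside := groth_in (iso_pi X).

Lemma bclass_iso X Y : biso X Y -> bclass X = bclass Y.
Proof. by move=> /iso_piP XY; rewrite /bclass XY. Qed.

Lemma bclassD X Y : bclass (dunion X Y) = bclass X + bclass Y.
Proof. by rewrite /bclass -groth_inD -iso_addE. Qed.

(* The additive extension to [B(H, G)] of a function on bisets that is
   invariant under isomorphism and additive on disjoint unions. *)
Definition blift (V : zmodType) (f : biset H G -> V) : burnside -> V :=
  groth_lift (fun c => f (iso_repr c)).

Section Lift.
Variables (V : zmodType) (f : biset H G -> V).
Hypothesis f_iso : forall X Y, biso X Y -> f X = f Y.
Hypothesis fD : forall X Y, f (dunion X Y) = f X + f Y.

Let f_reprD : {morph (fun c => f (iso_repr c)) : c d / c + d}.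
Proof.
by move=> c d; rewrite -fD; apply: f_iso; apply: iso_pi_repr.
Qed.

Lemma bliftE X : blift f (bclass X) = f X.
Proof. by rewrite /blift groth_liftE //; apply/f_iso/iso_pi_repr. Qed.

Lemma bliftD : {morph blift f : x y / x + y}.
Proof. exact: groth_liftD. Qed.
End Lift.

Lemma burnsideP (x : burnside) : exists X Y, x = bclass X - bclass Y.
Proof.
exists (iso_repr (groth_repr x).1), (iso_repr (groth_repr x).2).
by rewrite /bclass !iso_reprK -groth_piE groth_reprK.
Qed.
End IsoClasses.

(* The biadditive extension of [bcomp]; its value on classes is given by
   [burnside_compE] below. *)
Definition burnside_comp (K H G : finGroupType)
    (y : burnside K H) (x : burnside H G) : burnside K G :=
  blift (fun Y => blift (fun X => bclass (bcomp Y X)) x) y.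

Section BurnsideComp.
Variables K H G : finGroupType.

Lemma blift_ext (V : zmodType) (f f' : biset H G -> V) x :
  (forall X, f X = f' X) -> blift f x = blift f' x.
Proof. by move=> ff'; rewrite /blift /groth_lift !ff'. Qed.

Let comp_isor (Y : biset K H) (X X' : biset H G) :
  biso X X' -> bclass (bcomp Y X) = bclass (bcomp Y X').
Proof. by move=> XX'; apply/bclass_iso/biso_bcomp => //; apply: biso_refl. Qed.

Let comp_isol (Y Y' : biset K H) (X : biset H G) :
  biso Y Y' -> bclass (bcomp Y X) = bclass (bcomp Y' X).
Proof. by move=> YY'; apply/bclass_iso/biso_bcomp => //; apply: biso_refl. Qed.

Let compDr (Y : biset K H) (X X' : biset H G) :
  bclass (bcomp Y (dunion X X')) = bclass (bcomp Y X) + bclass (bcomp Y X').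
Proof. by rewrite -bclassD; apply/bclass_iso/biso_bcompDr. Qed.

Let compDl (Y Y' : biset K H) (X : biset H G) :
  bclass (bcomp (dunion Y Y') X) = bclass (bcomp Y X) + bclass (bcomp Y' X).
Proof. by rewrite -bclassD; apply/bclass_iso/biso_bcompDl. Qed.

Let inner (x : burnside H G) (Y : biset K H) :=
  blift (fun X => bclass (bcomp Y X)) x.

Let inner_iso x Y Y' : biso Y Y' -> inner x Y = inner x Y'.
Proof. by move=> YY'; apply: blift_ext => X; apply: comp_isol. Qed.

Let innerD x Y Y' : inner x (dunion Y Y') = inner x Y + inner x Y'.
Proof.
rewrite /inner /blift /groth_lift !compDl opprD.
exact: addrACA.
Qed.

Lemma burnside_compE (Y : biset K H) (X : biset H G) :
  burnside_comp (bclass Y) (bclass X) = bclass (bcomp Y X).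
Proof.
rewrite /burnside_comp (bliftE (@inner_iso _) (innerD _)).
by rewrite /inner (bliftE (@comp_isor _) (@compDr _)).
Qed.

Lemma burnside_compDl (y y' : burnside K H) (x : burnside H G) :
  burnside_comp (y + y') x = burnside_comp y x + burnside_comp y' x.
Proof. exact: bliftD (@inner_iso _) (innerD _) _ _. Qed.

Lemma burnside_compDr (y : burnside K H) (x x' : burnside H G) :
  burnside_comp y (x + x') = burnside_comp y x + burnside_comp y x'.
Proof.
have innerDr Y : inner (x + x') Y = inner x Y + inner x' Y.
  exact: bliftD (@comp_isor _) (@compDr _) _ _.
have compE z : burnside_comp y z = blift (inner z) y by [].
rewrite !compE /blift /groth_lift !innerDr opprD; exact: addrACA.
Qed.
End BurnsideComp.

Section ScalarExtension.
Variables (k : comPzRingType) (M : zmodType).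

(* Formal sums of pure tensors, modulo the congruence generated by
   biadditivity. *)
Inductive tensor_eq : seq (k * M) -> seq (k * M) -> Prop :=
| TensorRefl s : tensor_eq s s
| TensorSym s t : tensor_eq s t -> tensor_eq t s
| TensorTrans s t u : tensor_eq s t -> tensor_eq t u -> tensor_eq s u
| TensorCat s s' t : tensor_eq s s' -> tensor_eq (s ++ t) (s' ++ t)
| TensorC s t : tensor_eq (s ++ t) (t ++ s)
| Tensor0 : tensor_eq [:: (0, 0)] [::]
| TensorDl c d m : tensor_eq [:: (c + d, m)] [:: (c, m); (d, m)]
| TensorDr c m n : tensor_eq [:: (c, m + n)] [:: (c, m); (c, n)].

Definition tensor_eqb : rel (seq (k * M)) := fun s t => `[< tensor_eq s t >].

Lemma tensor_eqb_refl : reflexive tensor_eqb.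
Proof. by move=> s; apply/asboolP; constructor. Qed.
Lemma tensor_eqb_sym : symmetric tensor_eqb.
Proof. by move=> s t; apply/asboolP/asboolP; apply: TensorSym. Qed.
Lemma tensor_eqb_trans : transitive tensor_eqb.
Proof.
by move=> t s u /asboolP st /asboolP tu; apply/asboolP; apply: TensorTrans st tu.
Qed.

Canonical tensor_equiv :=
  EquivRel tensor_eqb tensor_eqb_refl tensor_eqb_sym tensor_eqb_trans.

Definition tensor : Type := {eq_quot tensor_equiv}.
HB.instance Definition _ := Choice.on tensor.

Definition tensor_pi (s : seq (k * M)) : tensor :=
  \pi_({eq_quot tensor_equiv}) s.
Definition tensor_repr (x : tensor) : seq (k * M) :=
  repr (x : {eq_quot tensor_equiv}).

Lemma tensor_reprK x : tensor_pi (tensor_repr x) = x.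
Proof. exact: (@reprK _ {eq_quot tensor_equiv}). Qed.

Lemma tensor_piP s t : tensor_pi s = tensor_pi t <-> tensor_eq s t.
Proof.
split; first by move/(@eqmodP _ tensor_equiv)/asboolP.
by move=> e; apply/(@eqmodP _ tensor_equiv)/asboolP.
Qed.

Let tensor_cat s s' t t' :
  tensor_eq s s' -> tensor_eq t t' -> tensor_eq (s ++ t) (s' ++ t').
Proof.
move=> ss' tt'; apply: TensorTrans (TensorCat _ ss') _.
apply: TensorTrans (TensorC _ _) _; apply: TensorTrans (TensorCat _ tt') _.
exact: TensorC.
Qed.

Let smap (a : k) := map (fun cm : k * M => (a * cm.1, cm.2)).

Let tensor_cons p s s' : tensor_eq s s' -> tensor_eq (p :: s) (p :: s').
Proof. exact: (@tensor_cat [:: p] _ _ _ (TensorRefl _)). Qed.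

Let tensor_0l m : tensor_eq [:: (0, m)] [::].
Proof.
apply: (@TensorTrans _ [:: (0, m); (0, m); (0, - m)]).
  apply/tensor_cons; apply: TensorTrans (TensorSym Tensor0) _.
  by rewrite -{1}(subrr m); apply: TensorDr.
apply: (@TensorTrans _ [:: (0, m); (0, - m)]).
  apply: (@TensorCat [:: _; _] [:: _] [:: _]); apply: TensorSym.
  by rewrite -{1}[0](addr0 0); apply: TensorDl.
apply: TensorTrans Tensor0; apply: TensorSym; rewrite -{1}(subrr m).
exact: TensorDr.
Qed.

Let smap_eq a s t : tensor_eq s t -> tensor_eq (smap a s) (smap a t).
Proof.
elim=> {s t} [s|s t _|s t u _ st _ tu|s s' t _|s t||c d m|c m n].
- exact: TensorRefl.
- exact: TensorSym.
- exact: TensorTrans st tu.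
- by rewrite /smap !map_cat => ss'; apply: TensorCat.
- by rewrite /smap !map_cat; apply: TensorC.
- by rewrite /= mulr0; apply: Tensor0.
- by rewrite /= mulrDr; apply: TensorDl.
- exact: TensorDr.
Qed.

Definition tensor_zero : tensor := tensor_pi [::].
Definition tensor_add (x y : tensor) : tensor :=
  tensor_pi (tensor_repr x ++ tensor_repr y).
Definition tensor_scale (a : k) (x : tensor) : tensor :=
  tensor_pi [seq (a * cm.1, cm.2) | cm <- tensor_repr x].
Definition tensor_opp (x : tensor) : tensor := tensor_scale (- 1) x.

Let tensor_repr_pi s : tensor_eq (tensor_repr (tensor_pi s)) s.
Proof. by apply/tensor_piP; rewrite tensor_reprK. Qed.

Lemma tensor_addE s t :
  tensor_add (tensor_pi s) (tensor_pi t) = tensor_pi (s ++ t).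
Proof. by apply/tensor_piP/tensor_cat. Qed.

Lemma tensor_scaleE a s :
  tensor_scale a (tensor_pi s) = tensor_pi [seq (a * cm.1, cm.2) | cm <- s].
Proof. by apply/tensor_piP/smap_eq. Qed.

Lemma tensor_addA : associative tensor_add.
Proof.
move=> x y z; rewrite -(tensor_reprK x) -(tensor_reprK y) -(tensor_reprK z).
by rewrite !tensor_addE catA.
Qed.
Lemma tensor_addC : commutative tensor_add.
Proof. by move=> x y; apply/tensor_piP/TensorC. Qed.
Lemma tensor_add0 : left_id tensor_zero tensor_add.
Proof. by move=> x; rewrite -(tensor_reprK x) tensor_addE. Qed.
Lemma tensor_addN : left_inverse tensor_zero tensor_opp tensor_add.
Proof.
move=> x; rewrite -(tensor_reprK x) /tensor_opp tensor_scaleE tensor_addE.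
apply/tensor_piP; elim: (tensor_repr x) => [|[c m] s IHs] /=.
  exact: TensorRefl.
set t := map _ s in IHs *.
apply: (@TensorTrans _ [:: (-1 * c, m), (c, m) & t ++ s]).
  apply/tensor_cons; apply: TensorTrans (TensorC t _) _.
  exact/tensor_cons/TensorC.
apply: TensorTrans IHs; apply: (@TensorCat [:: _; _] [::]).
apply: TensorTrans (TensorSym (TensorDl _ _ _)) _.
by rewrite mulN1r addNr.
Qed.

HB.instance Definition _ :=
  GRing.isZmodule.Build tensor tensor_addA tensor_addC tensor_add0 tensor_addN.

Lemma tensor_scaleA a b x :
  tensor_scale a (tensor_scale b x) = tensor_scale (a * b) x.
Proof.
rewrite -(tensor_reprK x) !tensor_scaleE -map_comp.
by congr tensor_pi; apply: eq_map => cm /=; rewrite mulrA.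
Qed.
Lemma tensor_scale1 : left_id 1 tensor_scale.
Proof.
move=> x; rewrite -(tensor_reprK x) tensor_scaleE; congr tensor_pi.
by rewrite -[RHS]map_id; apply: eq_map => -[c m] /=; rewrite mul1r.
Qed.
Lemma tensor_scaleDr : right_distributive tensor_scale +%R.
Proof.
move=> a x y; rewrite -(tensor_reprK x) -(tensor_reprK y).
by rewrite [_ + _]tensor_addE !tensor_scaleE [RHS]tensor_addE map_cat.
Qed.
Lemma tensor_scaleDl x :
  {morph (fun a => tensor_scale a x) : a b / a + b}.
Proof.
move=> a b; rewrite -(tensor_reprK x) !tensor_scaleE [RHS]tensor_addE.
apply/tensor_piP; elim: (tensor_repr x) => [|[c m] s IHs] /=.
  exact: TensorRefl.
set t := map _ s in IHs *; set u := map _ s in IHs *.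
set v := map _ s in IHs *.
apply: (@TensorTrans _ [:: (a * c, m), (b * c, m) & u ++ v]).
  apply: TensorTrans (tensor_cons _ IHs) _; rewrite mulrDl.
  exact: (@TensorCat [:: _] [:: _; _] _ (TensorDl _ _ _)).
apply/tensor_cons; apply: TensorTrans (tensor_cons _ (TensorC u v)) _.
exact: (TensorC (_ :: v) u).
Qed.

HB.instance Definition _ :=
  GRing.Zmodule_isLmodule.Build k tensor tensor_scaleA tensor_scale1
    tensor_scaleDr tensor_scaleDl.

Definition pure (c : k) (m : M) : tensor := tensor_pi [:: (c, m)].

Lemma pureDl c d m : pure (c + d) m = pure c m + pure d m.
Proof. by rewrite [RHS]tensor_addE; apply/tensor_piP/TensorDl. Qed.
Lemma pureDr c m n : pure c (m + n) = pure c m + pure c n.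
Proof. by rewrite [RHS]tensor_addE; apply/tensor_piP/TensorDr. Qed.
Lemma pureZ a c m : a *: pure c m = pure (a * c) m.
Proof. by rewrite [LHS]tensor_scaleE. Qed.

Lemma tensorE x : x = \sum_(cm <- tensor_repr x) pure cm.1 cm.2.
Proof.
rewrite -{1}(tensor_reprK x).
elim: (tensor_repr x) => [|[c m] s IHs]; first by rewrite big_nil.
by rewrite big_cons -IHs [RHS]tensor_addE.
Qed.

(* The [k]-linear extension to [k (x) M] of an additive map [M -> V]. *)
Definition tensor_lift (V : lmodType k) (f : M -> V) (x : tensor) : V :=
  \sum_(cm <- tensor_repr x) cm.1 *: f cm.2.

Section Lift.
Variables (V : lmodType k) (f : M -> V) (fD : {morph f : m n / m + n}).

Lemma tensor_lift_pi s :
  tensor_lift f (tensor_pi s) = \sum_(cm <- s) cm.1 *: f cm.2.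
Proof.
suff lift_eq s1 s2 : tensor_eq s1 s2 ->
    \sum_(cm <- s1) cm.1 *: f cm.2 = \sum_(cm <- s2) cm.1 *: f cm.2.
  exact: lift_eq (tensor_repr_pi s).
elim=> {s1 s2} //.
- by move=> s1 s2 s3 _ -> _ ->.
- by move=> s1 s2 s3 _ e; rewrite !big_cat /= e.
- by move=> s1 s2; rewrite !big_cat /= addrC.
- by rewrite big_seq1 big_nil scale0r.
- by move=> c d m; rewrite big_seq1 big_cons big_seq1 scalerDl.
- by move=> c m n; rewrite big_seq1 big_cons big_seq1 fD scalerDr.
Qed.

Lemma tensor_liftE c m : tensor_lift f (pure c m) = c *: f m.
Proof. by rewrite tensor_lift_pi big_seq1. Qed.

Lemma tensor_lift_linear a x y :
  tensor_lift f (a *: x + y) = a *: tensor_lift f x + tensor_lift f y.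
Proof.
rewrite -(tensor_reprK x) -(tensor_reprK y) [_ *: _]tensor_scaleE.
rewrite [_ + _]tensor_addE !tensor_lift_pi big_cat big_map scaler_sumr.
by congr (_ + _); apply: eq_bigr => cm _; rewrite scalerA.
Qed.
End Lift.
End ScalarExtension.

Section LinearizedBisets.
Variable k : comPzRingType.

Definition kburnside (H G : finGroupType) : lmodType k :=
  tensor k (burnside H G).

Definition kclass (H G : finGroupType) (X : biset H G) : kburnside H G :=
  pure 1 (bclass X).

(* The [k]-bilinear extension of [burnside_comp]; see [kcomp_class]. *)
Definition kcomp (K H G : finGroupType)
    (y : kburnside K H) (x : kburnside H G) : kburnside K G :=
  tensor_lift
    (fun b => tensor_lift (fun a => pure 1 (burnside_comp b a)) x) y.

Lemma kcomp_class (K H G : finGroupType) (Y : biset K H) (X : biset H G) :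
  kcomp (kclass Y) (kclass X) = kclass (bcomp Y X).
Proof.
have pD b : {morph (fun a : burnside H G => pure 1 (burnside_comp b a) :
    kburnside K G) : a a' / a + a'}.
  by move=> a a'; rewrite burnside_compDr pureDr.
rewrite /kcomp tensor_liftE => [|b b'].
  by rewrite tensor_liftE // !scale1r burnside_compE.
rewrite !tensor_liftE // !scale1r.
by rewrite burnside_compDl pureDr.
Qed.
End LinearizedBisets.

Lemma kclass_iso (k : comPzRingType) (H G : finGroupType) (X Y : biset H G) :
  biso X Y -> kclass k X = kclass k Y.
Proof. by move=> XY; rewrite /kclass (bclass_iso XY). Qed.

Section StructuralBisets.
Local Open Scope group_scope.

Section Homomorphism.
Variables (G H : finGroupType) (phi : {morphism [set: G] >-> H}).

Let phiM (x y : G) : phi (x * y) = phi x * phi y.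
Proof. by rewrite morphM ?inE. Qed.

Definition Ind : biset H G.
Proof.
exists H; exists (fun h x => h * x) (fun x g => x * phi g).
- exact: mul1g.
- by move=> h h' x; rewrite mulgA.
- by move=> x; rewrite morph1 mulg1.
- by move=> x g g'; rewrite phiM mulgA.
- by move=> h x g; rewrite mulgA.
Defined.

Definition Res : biset G H.
Proof.
exists H; exists (fun g x => phi g * x) (fun x h => x * h).
- by move=> x; rewrite morph1 mul1g.
- by move=> g g' x; rewrite phiM mulgA.
- exact: mulg1.
- by move=> x h h'; rewrite mulgA.
- by move=> g x h; rewrite mulgA.
Defined.
End Homomorphism.

Definition diag_fun (G : finGroupType) (g : G) : G * G := (g, g).

Lemma diag_morphM (G : finGroupType) :
  {in [set: G] &, {morph @diag_fun G : x y / x * y}}.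
Proof. by []. Qed.

Definition Diag (G : finGroupType) : {morphism [set: G] >-> G * G} :=
  Morphism (@diag_morphM G).

(* [Inf_G^{G x H}] and [Inf_H^{G x H}] *)
Definition Inf1 (G H : finGroupType) : biset (G * H)%type G :=
  Res (fst_morphism G H).
Definition Inf2 (G H : finGroupType) : biset (G * H)%type H :=
  Res (snd_morphism G H).

Definition trivial_group : finGroupType := 'I_1.

Definition arrow_right (G : finGroupType) : biset (G * G)%type trivial_group.
Proof.
exists G; exists (fun p x => p.1 * x * p.2^-1) (fun x _ => x) => //=.
- by move=> x; rewrite mul1g invg1 mulg1.
- by move=> p q x; rewrite invMg !mulgA.
Defined.

(* The group [K x H x H x G] is bracketed as [(K x H) x (H x G)], where [cross]
   takes its values. *)
Definition arrow_left (K H G : finGroupType) :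
  biset (K * G)%type ((K * H) * (H * G))%type.
Proof.
exists (K * H * G)%type; exists
  (fun (p : K * G) (x : K * H * G) => (p.1 * x.1.1, x.1.2, p.2 * x.2))
  (fun (x : K * H * G) (q : (K * H) * (H * G)) =>
     (x.1.1 * q.1.1, q.1.2^-1 * x.1.2 * q.2.1, x.2 * q.2.2)).
- by move=> [[a b] c] /=; rewrite !mul1g.
- by move=> p q [[a b] c] /=; rewrite !mulgA.
- by move=> [[a b] c] /=; rewrite !mulg1 invg1 mul1g.
- by move=> [[a b] c] [[k h1] [h2 g]] [[k' h1'] [h2' g']] /=;
    rewrite invMg !mulgA.
- by move=> p [[a b] c] q /=; rewrite !mulgA.
Defined.

End StructuralBisets.

(* A subquotient of [gT] is a group isomorphic to
   [K / H] for some [H <| K <= gT]. *)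
Record group_class := GroupClass {
  in_class :> finGroupType -> Prop;
  class_subquotient : forall (gT hT : finGroupType) (K H : {group gT}),
    in_class gT -> (H <| K)%g -> [set: hT]%g \isog (K / H)%g -> in_class hT;
  class_prod : forall gT hT : finGroupType,
    in_class gT -> in_class hT -> in_class (gT * hT)%type }.

Record obj (D : group_class) := Obj {
  obj_group :> finGroupType;
  obj_in : D obj_group }.

Definition prod_obj (D : group_class) (G H : obj D) : obj D :=
  Obj (class_prod (obj_in G) (obj_in H)).

Lemma trivial_in (D : group_class) (G : finGroupType) : D G -> D trivial_group.
Proof.
move=> DG; apply: (class_subquotient DG (normal_refl [set: G]%G)).
rewrite trivg_quotient; apply: trivial_isog => //; apply: card_le1_trivg.
by rewrite cardsT card_ord.
Qed.

(* The trivial group as an object of [D]; [G] only witnesses that [D] has an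
   object. *)
Definition one_obj (D : group_class) (G : obj D) : obj D :=
  Obj (trivial_in (obj_in G)).

Section BisetFunctors.
Variables (k : comPzRingType) (D : group_class).

Record is_biset_functor (F : obj D -> lmodType k)
    (map : forall G H : obj D, kburnside k H G -> {linear F G -> F H}) : Prop :=
  IsBisetFunctor {
    functor_linear : forall (G H : obj D) (c : k) (f g : kburnside k H G) a,
      map G H (c *: f + g) a = c *: map G H f a + map G H g a;
    functor_comp : forall (G H K : obj D)
      (g : kburnside k K H) (f : kburnside k H G) a,
      map G K (kcomp g f) a = map H K g (map G H f a);
    functor_id : forall (G : obj D) a,
      map G G (kclass k (regular_biset G)) a = a }.

End BisetFunctors.

(* [lalgType] and [algType] exclude the zero ring, which [A G] may be. *)

Record algebra_on (k : comPzRingType) (V : lmodType k) := AlgebraOn {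
  amul : V -> V -> V;
  aone : V;
  amulA : associative amul;
  amul1x : left_id aone amul;
  amulx1 : right_id aone amul;
  amulDl : left_distributive amul +%R;
  amulDr : right_distributive amul +%R;
  ascaleAl : forall (c : k) (u v : V), c *: amul u v = amul (c *: u) v;
  ascaleAr : forall (c : k) (u v : V), c *: amul u v = amul u (c *: v) }.

Definition algebra_hom (k : comPzRingType) (U V : lmodType k)
    (mulU : U -> U -> U) (oneU : U) (mulV : V -> V -> V) (oneV : V)
    (f : U -> V) : Prop :=
  [/\ linear f, f oneU = oneV & {morph f : a b / mulU a b >-> mulV a b}].

Record green_functor (k : comPzRingType) (D : group_class) := GreenFunctor {
  green_obj :> obj D -> lmodType k;
  green_map : forall G H : obj D,
    kburnside k H G -> {linear green_obj G -> green_obj H};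
  green_algebra : forall G : obj D, algebra_on (green_obj G);
  green_is_functor : is_biset_functor (@green_map);
  green_res : forall (G H : obj D) (phi : {morphism [set: G] >-> H}),
    algebra_hom (amul (green_algebra H)) (aone (green_algebra H))
                (amul (green_algebra G)) (aone (green_algebra G))
                (@green_map H G (kclass k (Res phi)));
  green_frobeniusl : forall (G H : obj D) (phi : {morphism [set: G] >-> H})
    (a : green_obj H) (b : green_obj G),
    amul (green_algebra H) a (@green_map G H (kclass k (Ind phi)) b) =
    @green_map G H (kclass k (Ind phi))
      (amul (green_algebra G) (@green_map H G (kclass k (Res phi)) a) b);
  green_frobeniusr : forall (G H : obj D) (phi : {morphism [set: G] >-> H})
    (a : green_obj H) (b : green_obj G),
    amul (green_algebra H) (@green_map G H (kclass k (Ind phi)) b) a =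
    @green_map G H (kclass k (Ind phi))
      (amul (green_algebra G) b (@green_map H G (kclass k (Res phi)) a)) }.

Section AssociatedCategory.
Variables (k : comPzRingType) (D : group_class) (A : green_functor k D).

Definition green_biset (G H : obj D) (X : biset H G) : {linear A G -> A H} :=
  @green_map k D A G H (kclass k X).

Definition gmul (G : obj D) : A G -> A G -> A G := amul (green_algebra A G).
Definition gone (G : obj D) : A G := aone (green_algebra A G).

Definition cross (G H : obj D) (a : A G) (b : A H) : A (prod_obj G H) :=
  @gmul (prod_obj G H)
    (@green_biset G (prod_obj G H) (Inf1 G H) a)
    (@green_biset H (prod_obj G H) (Inf2 G H) b).

Definition PHom (G H : obj D) : lmodType k := A (prod_obj H G).

Definition Pcomp (G H K : obj D) (alpha : PHom H K) (beta : PHom G H) :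
    PHom G K :=
  @green_biset (prod_obj (prod_obj K H) (prod_obj H G)) (prod_obj K G)
    (arrow_left K H G) (cross alpha beta).

Definition Pid (G : obj D) : PHom G G :=
  @green_biset (one_obj G) (prod_obj G G) (arrow_right G) (gone (one_obj G)).

Definition tilde (G : obj D) (a : A G) : PHom G G :=
  @green_biset G (prod_obj G G) (Ind (Diag G)) a.

End AssociatedCategory.

(* Main.v *)
Require Import Defs.
From mathcomp Require Import all_boot all_order all_fingroup all_algebra.
(* [action.ract] shadows the right action of bisets. *)
Import Defs.

(* Inflation commutes with induction (a Mackey square), so the Frobenius
   relations give [Ind(phi)(a) x Ind(psi)(b) = Ind(phi x psi)(a x b)].  As
   [(G x <-G x G) o Ind(Delta x Delta)] and [Ind(Delta) o Res(Delta)] are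
   isomorphic bisets and [Res(Delta)(a x b) = a b], the map [tilde] is
   multiplicative.  Since [Delta] is a section of the first projection [p],
   [Ind(p)] is a left inverse of [tilde]. *)

Set Implicit Arguments.
Unset Strict Implicit.
Unset Printing Implicit Defensive.

Section Bisets.
Local Open Scope group_scope.

(** * Recognising a composite of bisets by a balanced map *)

Section BisoBcomp.
Variables (K H G : finGroupType) (Y : biset K H) (X : biset H G).
Variables (Z : biset K G) (f : Y -> X -> Z).
Hypothesis f_balanced : forall y h x, f (ract Y y h) x = f y (lact X h x).
Hypothesis f_separates : forall y x y' x', f y x = f y' x' ->
  exists h, y = ract Y y' h /\ x' = lact X h x.
Hypothesis f_surj : forall z, exists y x, f y x = z.
Hypothesis f_lact : forall l y x, f (lact Y l y) x = lact Z l (f y x).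
Hypothesis f_ract : forall y x g, f y (ract X x g) = ract Z (f y x) g.

(** A balanced map factors through the quotient, and [f_separates] says that each of its fibres is a
    single class, so the induced map is injective. The composites below are identified by exhibiting
    such an [f]. *)
Lemma biso_bcomp_balanced : biso (bcomp Y X) Z.
Proof.
pose F (z : bcomp Y X) : Z := f (tens_repr z).1 (tens_repr z).2.
have FE p : F (tens_pi p) = f p.1 p.2.
  have /tens_piP[h [e1 e2]] := tens_reprK (tens_pi p).
  by rewrite /F e1 e2 f_balanced.
(* Boolean equality lets [xchoose] turn surjectivity into an inverse map. *)
have F_surj z : exists w, F w == z.
  by have [y [x <-]] := f_surj z; exists (tens_pi (y, x)); rewrite FE.
have F_inj : injective F.
  move=> z w; rewrite -(tens_reprK z) -(tens_reprK w) !FE => e.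
  exact/tens_piP/f_separates.
have FK z : F (xchoose (F_surj z)) = z by apply/eqP/(xchooseP (F_surj z)).
exists F; split.
- by exists (fun z => xchoose (F_surj z)) => // z; apply: F_inj; rewrite FK.
- by move=> l z; rewrite -(tens_reprK z) /= tens_lactE !FE f_lact.
- by move=> z g; rewrite -(tens_reprK z) /= tens_ractE !FE f_ract.
Qed.
End BisoBcomp.

Lemma setT_morphM (G H : finGroupType) (phi : {morphism [set: G] >-> H}) x y :
  phi (x * y) = phi x * phi y.
Proof. by rewrite morphM ?inE. Qed.

Lemma setT_morphV (G H : finGroupType) (phi : {morphism [set: G] >-> H}) x :
  phi x^-1 = (phi x)^-1.
Proof. by rewrite morphV ?inE. Qed.

(** * Composites of inductions and restrictions *)

Section Pullback.
Variables (K K' H' H : finGroupType) (X : biset K H).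
Variables (phi : {morphism [set: K'] >-> K}) (psi : {morphism [set: H'] >-> H}).

(** The carrier stays that of [X], so composites with [Ind] can be described without a quotient. *)
Definition pullback : biset K' H'.
Proof.
exists X; exists (fun l x => lact X (phi l) x) (fun x h => ract X x (psi h)).
- by move=> x; rewrite morph1 lact1.
- by move=> l l' x; rewrite setT_morphM lactM.
- by move=> x; rewrite morph1 ract1.
- by move=> x h h'; rewrite setT_morphM ractM.
- by move=> l x h; rewrite lractA.
Defined.
End Pullback.

(** The class of [(x, h)] has exactly one representative with second entry 1, namely [(x h, 1)]. *)
Lemma biso_bcomp_Ind (K H H' : finGroupType) (X : biset K H)
    (psi : {morphism [set: H'] >-> H}) :
  biso (bcomp X (Ind psi)) (pullback X (idm _) psi).
Proof.
apply: (@biso_bcomp_balanced _ _ _ X (Ind psi) (pullback X (idm _) psi)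
  (fun x h => ract X x h)) => /=.
- by move=> x h h'; rewrite -ractM.
- move=> y h y' h' e; exists (h' * h^-1); split; last by rewrite mulgKV.
  by rewrite ractM -e -ractM mulgV ract1.
- by move=> x; exists x, 1; rewrite ract1.
- by move=> l x h; rewrite lractA.
- by move=> x h g; rewrite ractM.
Qed.

Lemma biso_Ind_comp (K H G : finGroupType) (phi : {morphism [set: H] >-> K})
    (psi : {morphism [set: G] >-> H}) (chi : {morphism [set: G] >-> K}) :
  (forall g, chi g = phi (psi g)) -> biso (bcomp (Ind phi) (Ind psi)) (Ind chi).
Proof.
move=> chiE; apply: biso_trans (biso_bcomp_Ind _ _) _.
exists id; split=> //; first by exists id.
by move=> x g /=; rewrite chiE.
Qed.

Lemma biso_Ind_id (G : finGroupType) (phi : {morphism [set: G] >-> G}) :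
  (forall g, phi g = g) -> biso (Ind phi) (regular_biset G).
Proof.
move=> phiE; exists id; split=> //; first by exists id.
by move=> x g /=; rewrite phiE.
Qed.

Lemma biso_Res_id (G : finGroupType) (phi : {morphism [set: G] >-> G}) :
  (forall g, phi g = g) -> biso (Res phi) (regular_biset G).
Proof.
move=> phiE; exists id; split=> //; first by exists id.
by move=> h x /=; rewrite phiE.
Qed.

Lemma biso_Res_comp (K H G : finGroupType) (phi : {morphism [set: H] >-> K})
    (psi : {morphism [set: G] >-> H}) (chi : {morphism [set: G] >-> K}) :
  (forall g, chi g = phi (psi g)) -> biso (bcomp (Res psi) (Res phi)) (Res chi).
Proof.
move=> chiE.
apply: (@biso_bcomp_balanced _ _ _ (Res psi) (Res phi) (Res chi)
  (fun h x => (phi h * x : Res chi))) => /=.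
- by move=> y h x; rewrite setT_morphM mulgA.
- move=> y x y' x' e; exists (y'^-1 * y); split; first by rewrite mulKVg.
  by rewrite setT_morphM setT_morphV -mulgA e mulKg.
- by move=> x; exists 1, x; rewrite morph1 mul1g.
- by move=> g h x; rewrite setT_morphM chiE mulgA.
- by move=> y x g; rewrite mulgA.
Qed.

(* [Q] maps onto the fibre product of [alpha] and [beta], and [P x G] acts
   transitively on [H], so that the Mackey formula has a single term. *)
Lemma biso_Mackey (H P G Q : finGroupType)
    (alpha : {morphism [set: P] >-> H}) (beta : {morphism [set: G] >-> H})
    (gamma : {morphism [set: Q] >-> P}) (delta : {morphism [set: Q] >-> G}) :
    (forall q, alpha (gamma q) = beta (delta q)) ->
    (forall p g, alpha p = beta g -> exists q, gamma q = p /\ delta q = g) ->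
    (forall h, exists p g, alpha p * beta g = h) ->
  biso (bcomp (Res alpha) (Ind beta)) (bcomp (Ind gamma) (Res delta)).
Proof.
move=> comm fibre trans; apply: biso_trans (biso_bcomp_Ind _ _) (biso_sym _).
apply: (@biso_bcomp_balanced _ _ _ (Ind gamma) (Res delta)
  (pullback (Res alpha) (idm _) beta)
  (fun p g => (alpha p * beta g : pullback (Res alpha) (idm _) beta))) => //=.
- by move=> p q g; rewrite !setT_morphM comm mulgA.
- move=> p g p' g' e.
  (* The equality [e] rearranges to [alpha (p'^-1 p) = beta (g' g^-1)], so this pair lies in the
     fibre product and lifts to [Q]. *)
  have [|q [qp qg]] := fibre (p'^-1 * p) (g' * g^-1).
    by rewrite !setT_morphM !setT_morphV -(mulgK (beta g) (alpha p)) e !mulgA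
      mulVg mul1g.
  by exists q; rewrite qp qg mulKVg mulgKV.
- by move=> l p g; rewrite setT_morphM mulgA.
- by move=> p g g'; rewrite setT_morphM mulgA.
Qed.

(** * Inflation and induction along product homomorphisms *)

Section ProductMorphism.
Variables (G G' H H' : finGroupType).
Variables (phi : {morphism [set: G] >-> G'}) (psi : {morphism [set: H] >-> H'}).

Definition prodm_fun (p : G * H) : G' * H' := (phi p.1, psi p.2).

Lemma prodm_morphM : {in [set: G * H] &, {morph prodm_fun : x y / x * y}}.
Proof. by move=> x y _ _; rewrite /prodm_fun !setT_morphM. Qed.

Definition prodm : {morphism [set: G * H] >-> G' * H'} := Morphism prodm_morphM.
End ProductMorphism.

(** The fibre product of the projection [G' x H -> G'] and [phi] is [G x H], and surjectivity of the
    projection gives transitivity. *)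
Lemma biso_Inf1_Ind (G G' H : finGroupType) (phi : {morphism [set: G] >-> G'}) :
  biso (bcomp (Inf1 G' H) (Ind phi))
       (bcomp (Ind (prodm phi (idm [set: H]))) (Inf1 G H)).
Proof.
apply: biso_Mackey => //=.
- by move=> [g' h] g /= ->; exists (g, h).
- by move=> g'; exists (g', 1), 1; rewrite morph1 mulg1.
Qed.

Lemma biso_Inf2_Ind (G H H' : finGroupType) (psi : {morphism [set: H] >-> H'}) :
  biso (bcomp (Inf2 G H') (Ind psi))
       (bcomp (Ind (prodm (idm [set: G]) psi)) (Inf2 G H)).
Proof.
apply: biso_Mackey => //=.
- by move=> [g h'] h /= ->; exists (g, h).
- by move=> h'; exists (1, h'), 1; rewrite morph1 mulg1.
Qed.

(** * The bisets defining identity and composition in the associated category *)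

Definition trivm_to (G : finGroupType) : {morphism [set: G] >-> trivial_group} :=
  trivm [set: G].

(** The left side is the coset space of the diagonal in [G x G], and [(a, b) -> a b^-1] identifies
    it with [G]. *)
Lemma biso_Ind_Diag_Res_trivm (G : finGroupType) :
  biso (bcomp (Ind (Diag G)) (Res (trivm_to G))) (arrow_right G).
Proof.
apply: (@biso_bcomp_balanced _ _ _ (Ind (Diag G)) (Res (trivm_to G))
  (arrow_right G) (fun p _ => (p.1 * p.2^-1 : arrow_right G))) => //=.
- by move=> [a b] g x; rewrite /= invMg mulgA mulgK.
- move=> [a b] x [a' b'] x' /= e; exists (b'^-1 * b); split.
    by congr (_, _); rewrite ?mulKVg // mulgA -e mulgKV.
  by rewrite (ord1 x) (ord1 x') (ord1 (_ * _)).
- by move=> g; exists (g, 1), 1; rewrite invg1 mulg1.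
- by move=> [a b] [a' b'] x /=; rewrite invMg !mulgA.
Qed.

(** Balancing over the diagonal leaves [((a, b), (c, d))] with the three invariants [a c], [c^-1 d]
    and [b d], which determine its class. *)
Lemma biso_arrow_left_Ind_Diag (G : finGroupType) :
  biso (bcomp (arrow_left G G G) (Ind (prodm (Diag G) (Diag G))))
       (bcomp (Ind (Diag G)) (Res (Diag G))).
Proof.
apply: biso_trans (biso_bcomp_Ind _ _) (biso_sym _).
set Z := pullback _ _ _.
apply: (@biso_bcomp_balanced _ _ _ (Ind (Diag G)) (Res (Diag G)) Z
  (fun u v => ((u.1 * v.1, v.1^-1 * v.2, u.2 * v.2) : Z))) => /=.
- by move=> [a b] g [c d] /=; rewrite invMg !mulgA mulgKV.
- move=> [a b] [c d] [a' b'] [c' d'] /= [e1 e2 e3].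
  exists (c' * c^-1).
  (* Equality of the middle invariants makes one element of [G] carry both [c] to [c'] and [d] to
     [d']. *)
  have e4 : c' * c^-1 = d' * d^-1.
    by apply: (mulgI c'^-1); rewrite mulKg mulgA -e2 mulgK.
  split; last by congr (_, _); rewrite ?mulgKV // e4 mulgKV.
  by congr (_, _); [rewrite mulgA -e1 mulgK | rewrite e4 mulgA -e3 mulgK].
(* The preimage is normalised so that the first entry of its second factor is 1. *)
- move=> [[a b] c]; exists (a, c * b^-1), (1, b).
  by rewrite /= mulg1 invg1 mul1g mulgKV.
- by move=> [x y] [a b] [c d] /=; rewrite !mulgA.
- by move=> [a b] [c d] [x y] /=; rewrite invMg !mulgA.
Qed.
End Bisets.

(** * External products and the map [tilde] in a Green functor *)

Section GreenFunctor.
Variables (k : comPzRingType) (D : group_class) (A : green_functor k D).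
Implicit Types G H K : obj D.

Lemma green_biset_comp G H K (Y : biset K H) (X : biset H G) (a : A G) :
  green_biset A (G := G) (H := K) (bcomp Y X) a =
  green_biset A (G := H) (H := K) Y (green_biset A (G := G) (H := H) X a).
Proof.
by rewrite /green_biset -kcomp_class (functor_comp (green_is_functor A)).
Qed.

Lemma green_biset_iso G H (X Y : biset H G) (a : A G) :
  biso X Y -> green_biset A (G := G) (H := H) X a = green_biset A Y a.
Proof. by move=> /(kclass_iso k) e; rewrite /green_biset e. Qed.

Lemma green_biset_regular G (a : A G) :
  green_biset A (G := G) (H := G) (regular_biset G) a = a.
Proof. exact: (functor_id (green_is_functor A)). Qed.

Lemma green_biset_ResM G H (phi : {morphism [set: G] >-> H}) (a b : A H) :
  green_biset A (G := H) (H := G) (Res phi) (gmul a b) =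
  gmul (green_biset A (Res phi) a) (green_biset A (Res phi) b).
Proof. by have [_ _ resM] := @green_res k D A G H phi; apply: resM. Qed.

Lemma green_biset_Res1 G H (phi : {morphism [set: G] >-> H}) :
  green_biset A (G := H) (H := G) (Res phi) (gone A H) = gone A G.
Proof. by have [_ res1 _] := @green_res k D A G H phi. Qed.

Lemma cross_Indl G G' H (phi : {morphism [set: G] >-> G'}) (a : A G) (c : A H) :
  cross (green_biset A (G := G) (H := G') (Ind phi) a) c =
  green_biset A (G := prod_obj G H) (H := prod_obj G' H)
    (Ind (prodm phi (idm _))) (cross a c).
Proof.
rewrite /cross -green_biset_comp.
rewrite (@green_biset_iso G (prod_obj G' H) _ _ _ (biso_Inf1_Ind H phi)).
rewrite (@green_biset_comp G (prod_obj G H) (prod_obj G' H)).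
rewrite /gmul [LHS](@green_frobeniusr k D A (prod_obj G H) (prod_obj G' H)).
(* The other factor remains an inflation of [c], as [phi x id] commutes with the second
   projections. *)
congr (green_biset _ _ (amul _ _ _)); rewrite -[LHS]green_biset_comp.
exact/green_biset_iso/biso_Res_comp.
Qed.

Lemma cross_Indr G H H' (psi : {morphism [set: H] >-> H'}) (c : A G) (b : A H) :
  cross c (green_biset A (G := H) (H := H') (Ind psi) b) =
  green_biset A (G := prod_obj G H) (H := prod_obj G H')
    (Ind (prodm (idm _) psi)) (cross c b).
Proof.
rewrite /cross -green_biset_comp.
rewrite (@green_biset_iso H (prod_obj G H') _ _ _ (biso_Inf2_Ind G psi)).
rewrite (@green_biset_comp H (prod_obj G H) (prod_obj G H')).
rewrite /gmul [LHS](@green_frobeniusl k D A (prod_obj G H) (prod_obj G H')).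
congr (green_biset _ _ (amul _ _ _)); rewrite -[LHS]green_biset_comp.
exact/green_biset_iso/biso_Res_comp.
Qed.

Lemma cross_Ind G G' H H' (phi : {morphism [set: G] >-> G'})
    (psi : {morphism [set: H] >-> H'}) (a : A G) (b : A H) :
  cross (green_biset A (G := G) (H := G') (Ind phi) a)
        (green_biset A (G := H) (H := H') (Ind psi) b) =
  green_biset A (G := prod_obj G H) (H := prod_obj G' H')
    (Ind (prodm phi psi)) (cross a b).
Proof.
(* Factor [phi x psi] as [phi x id] after [id x psi]. *)
rewrite cross_Indl cross_Indr -green_biset_comp.
exact/green_biset_iso/biso_Ind_comp.
Qed.

(** Restriction is multiplicative, and each projection composed with the diagonal is the identity,
    so both inflations are undone. *)
Lemma Res_Diag_cross G (a b : A G) :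
  green_biset A (G := prod_obj G G) (H := G) (Res (Diag G)) (cross a b) =
  gmul a b.
Proof.
rewrite [LHS](@green_biset_ResM G (prod_obj G G)) -!green_biset_comp.
by congr gmul; rewrite -[RHS]green_biset_regular; apply: green_biset_iso;
  apply: biso_trans (biso_Res_comp (chi := idm _) _) (biso_Res_id _).
Qed.

Lemma tilde_mul G (a b : A G) : tilde (gmul a b) = Pcomp (tilde a) (tilde b).
Proof.
rewrite /Pcomp /tilde cross_Ind -Res_Diag_cross -!green_biset_comp.
exact/green_biset_iso/biso_sym/biso_arrow_left_Ind_Diag.
Qed.

(** The unit of [A G] is the restriction of the unit of [A 1] along [G -> 1], so both sides are
    images of that unit under isomorphic bisets. *)
Lemma tilde_one G : tilde (gone A G) = Pid A G.
Proof.
rewrite /tilde -(@green_biset_Res1 G (one_obj G) (trivm_to G)).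
rewrite -green_biset_comp.
exact/green_biset_iso/biso_Ind_Diag_Res_trivm.
Qed.

Lemma tilde_inj G : injective (@tilde k D A G).
Proof.
apply: (can_inj (g := green_biset A (G := prod_obj G G) (H := G)
  (Ind (fst_morphism G G)))) => a.
rewrite /tilde -green_biset_comp -[RHS]green_biset_regular.
apply: green_biset_iso.
exact: biso_trans (biso_Ind_comp (chi := idm _) _) (biso_Ind_id _).
Qed.
End GreenFunctor.

Theorem proposition3p2 (k : comPzRingType) (D : group_class)
    (A : green_functor k D) (G : obj D) :
  algebra_hom (@gmul k D A G) (@gone k D A G)
              (@Pcomp k D A G G G) (@Pid k D A G)
              (@tilde k D A G)
  /\ injective (@tilde k D A G).
Proof.
split; last exact: tilde_inj.
split; [exact: GRing.linearP | exact: tilde_one | exact: tilde_mul].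
Qed.
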